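(* There is a unique infinitely differentiable function with compact support $\varphi\colon\mathbb{R}\to\mathbb{R}$ such that: (a) $\operatorname{supp}(\varphi)=[-1,1]$; (b) $\varphi(t)>0$ for every $t$ in the open interval $(-1,1)$; (c) $\varphi(0)=1$; (d) there is a constant $k>0$ such that for every $t\in\mathbb{R}$ \[ \varphi'(t)=k\bigl(\varphi(2t+1)-\varphi(2t-1)\bigr). \] Moreover, the constant $k$ appearing in (d) is necessarily equal to $2$.
   Context: $\operatorname{supp}(\varphi)$ denotes the closure of $\{t\in\mathbb{R}:\varphi(t)\neq 0\}$. Uniqueness is among all infinitely differentiable compactly supported functions satisfying (a)–(d), where the constant $k>0$ in (d) is allowed to depend on the function. *)

(* Defs.v *)
From Stdlib Require Import Reals.
From Coquelicot Require Import Coquelicot.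
Open Scope R_scope.

Definition smooth (f : R -> R) : Prop :=
  forall (n : nat) (t : R), ex_derive_n f n t.

(* [adherence] is the topological closure in R, and [compact] is the
   open-cover notion, both from Stdlib's Rtopology. *)
Definition supp (f : R -> R) : R -> Prop := adherence (fun t => f t <> 0).

Definition test_function (f : R -> R) : Prop := smooth f /\ compact (supp f).

Definition normalized_bump (f : R -> R) : Prop :=
  (forall t : R, supp f t <-> -1 <= t <= 1) /\
  (forall t : R, -1 < t < 1 -> f t > 0) /\
  f 0 = 1.

(* [Derive] is total; it is the genuine derivative here because the equation
   is only ever imposed on smooth functions. *)
Definition delay_equation (k : R) (f : R -> R) : Prop :=
  forall t : R, Derive f t = k * (f (2 * t + 1) - f (2 * t - 1)).

(* Main.v *)
Require Import Defs.
From Stdlib Require Import Reals Lra Lia FunctionalExtensionality.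
From Coquelicot Require Import Coquelicot.
Open Scope R_scope.

(** Integrating the delay equation from -infinity turns it into
    [f t = k / 2 * RInt f (2 * t - 1) (2 * t + 1)].  The window integral
    [smoothing f t] on the right has a probabilistic meaning: if [X] has density
    [f] and [U] is uniform on [-1, 1] and independent of [X], it is the density
    of [(X + U) / 2].  The function sought is thus the density of the sum of
    the [U_n / 2 ^ n], [n >= 1], with independent [U_n] uniform on [-1, 1],
    characterized as the only fixed point of [smoothing].

    The useful invariant is that the integer translates of the function sum to
    a constant: [tiling c f] says that [f] is continuous, vanishes off (-1, 1),
    and satisfies [f t + f (t - 1) = c] on [0, 1].  Then [f 0 = c], the integral
    of [f] is also [c] ([tiling_mass]), and [smoothing] preserves the property
    because two windows whose centres differ by 2 abut and together cover the
    whole support.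

    For the constant, let [I] be the integral of a solution [f].  The same
    juxtaposition of windows gives [f t + f (t - 1) = k / 2 * I] on [0, 1], and
    [t = 0] shows that the value is 1.  Hence [f] tiles with constant 1, so
    [I = 1] and [k = 2] ([delay_constant]), and [f] is a fixed point of
    [smoothing].

    Existence and uniqueness come from a contraction.  In the sup norm
    [smoothing] is only nonexpansive, but the difference [d] of two densities
    vanishes at -1, 0 and 1, and for the weight [x * (1 - x)], [x = t + 1]
    modulo 1, it contracts by 2/3 ([smoothing_dominated_parabola]).  One
    application of [smoothing] produces a bound by a multiple of this weight
    from a mere sup bound ([smoothing_dominated_const]); so the [n + 1]st
    iterates of any two densities differ by at most [(2 / 3) ^ n]
    ([iter_contraction]).  Two fixed points therefore coincide, and the iterates
    of the hat function are uniformly Cauchy; their limit is a fixed point,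
    which the integral form makes differentiable and the delay equation then
    makes smooth.  Positivity spreads from [f 0 = 1]: [smoothing f t] is
    positive as soon as [f] is positive somewhere in the window around
    [2 * t]. *)

(** * The smoothing operator and functions with constant sum of translates *)

Definition smoothing (f : R -> R) (t : R) : R := RInt f (2 * t - 1) (2 * t + 1).

Record tiling (c : R) (f : R -> R) : Prop := {
  tiling_continuous : forall t, continuous f t;
  tiling_outside : forall t, 1 <= Rabs t -> f t = 0;
  tiling_sum : forall t, 0 <= t <= 1 -> f t + f (t - 1) = c }.

Lemma continuous_ex_RInt (f : R -> R) (a b : R) :
  (forall t, continuous f t) -> ex_RInt f a b.
Proof. intros Hf; apply (ex_RInt_continuous f); auto. Qed.

Lemma RInt_cut (f : R -> R) (b a c : R) :
  (forall t, continuous f t) -> RInt f a c = RInt f a b + RInt f b c.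
Proof.
  intros Hf; symmetry; apply (RInt_Chasles f); now apply continuous_ex_RInt.
Qed.

Lemma RInt_zero (f : R -> R) (a b : R) :
  a <= b -> (forall t, a < t < b -> f t = 0) -> RInt f a b = 0.
Proof.
  intros Hab Hf.
  rewrite (RInt_ext f (fun _ => 0)).
  - rewrite RInt_const. unfold scal; simpl; unfold mult; simpl; ring.
  - rewrite Rmin_left, Rmax_right by lra; auto.
Qed.

Lemma tiling_left c f t : tiling c f -> t <= -1 -> f t = 0.
Proof.
  intros Hf Ht; apply (tiling_outside c f Hf); rewrite Rabs_left; lra.
Qed.

Lemma tiling_right c f t : tiling c f -> 1 <= t -> f t = 0.
Proof.
  intros Hf Ht; apply (tiling_outside c f Hf); rewrite Rabs_right; lra.
Qed.

Lemma tiling_at_0 c f : tiling c f -> f 0 = c.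
Proof.
  intros Hf. generalize (tiling_sum c f Hf 0 ltac:(lra)).
  rewrite (tiling_left c f (0 - 1)); [lra | easy | lra].
Qed.

Lemma tiling_minus a b f g :
  tiling a f -> tiling b g -> tiling (a - b) (fun t => f t - g t).
Proof.
  intros Hf Hg; split.
  - intros t; apply (continuous_minus f g);
      [apply (tiling_continuous a) | apply (tiling_continuous b)]; easy.
  - intros t Ht.
    rewrite (tiling_outside a f), (tiling_outside b g); [ring | easy..].
  - intros t Ht.
    rewrite <- (tiling_sum a f Hf t Ht), <- (tiling_sum b g Hg t Ht); ring.
Qed.

Lemma tiling_bounded f t :
  tiling 1 f -> (forall t, 0 <= f t) -> f t <= 1.
Proof.
  intros Hf Hpos.
  destruct (Rle_dec 1 (Rabs t)) as [Ht | Ht].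
  - rewrite (tiling_outside 1 f); lra || easy.
  - assert (t < 1 /\ - (1) < t) by (apply Rabs_def2; lra).
    destruct (Rle_dec 0 t).
    + generalize (tiling_sum 1 f Hf t ltac:(lra)) (Hpos (t - 1)); lra.
    + generalize (tiling_sum 1 f Hf (t + 1) ltac:(lra)) (Hpos (t + 1)).
      replace (t + 1 - 1) with t by ring; lra.
Qed.

(** Cutting [-1, 1] at 0 and translating the left half onto [0, 1] leaves the
    integral of the constant [c] over an interval of length 1. *)
Lemma tiling_mass c f a b :
  tiling c f -> a <= -1 -> 1 <= b -> RInt f a b = c.
Proof.
  intros Hf Ha Hb.
  assert (Hc := tiling_continuous c f Hf).
  rewrite (RInt_cut f (-1)), (RInt_cut f 1 (-1)), (RInt_cut f 0 (-1)) by easy.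
  rewrite (RInt_zero f a), (RInt_zero f 1 b); try lra.
  2: intros t Ht; apply (tiling_right c); lra || easy.
  2: intros t Ht; apply (tiling_left c); lra || easy.
  assert (E : RInt f (-1) 0 = RInt (fun t => f (t - 1)) 0 1).
  { replace (-1) with (1 * 0 + -1) by ring.
    replace 0 with (1 * 1 + -1) at 2 by ring.
    rewrite <- (RInt_comp_lin f).
    - apply RInt_ext; intros t _.
      transitivity (1 * f (1 * t + -1)); [easy |].
      rewrite Rmult_1_l; f_equal; ring.
    - now apply continuous_ex_RInt. }
  rewrite E.
  assert (E' : RInt (fun t => f (t - 1) + f t) 0 1
          = RInt (fun t => f (t - 1)) 0 1 + RInt f 0 1).
  { apply (RInt_plus (fun t => f (t - 1)) f); apply continuous_ex_RInt; auto.
    intros t; apply (continuous_comp (fun t => t - 1) f); auto.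
    apply (continuous_minus (fun t : R => t) (fun _ => 1)).
    - apply continuous_id.
    - apply continuous_const. }
  rewrite (RInt_ext _ (fun _ => c)), RInt_const in E'.
  - unfold scal in E'; simpl in E'; unfold mult in E'; simpl in E'; lra.
  - intros t; rewrite Rmin_left, Rmax_right by lra; intros Ht.
    rewrite <- (tiling_sum c f Hf t); lra.
Qed.

Lemma is_derive_smoothing f t :
  (forall t, continuous f t) ->
  is_derive (smoothing f) t (2 * (f (2 * t + 1) - f (2 * t - 1))).
Proof.
  intros Hf; unfold smoothing.
  replace (2 * (f (2 * t + 1) - f (2 * t - 1)))
    with (minus (scal 2 (f (2 * t + 1))) (scal 2 (f (2 * t - 1)))).
  2: unfold minus, plus, opp, scal; simpl; unfold mult; simpl; ring.
  apply (is_derive_RInt_bound_comp f (RInt f)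
           (fun t => 2 * t - 1) (fun t => 2 * t + 1)); auto.
  - apply filter_forall; intros u.
    apply (RInt_correct f); now apply continuous_ex_RInt.
  - auto_derive; [easy | ring].
  - auto_derive; [easy | ring].
Qed.

Lemma smoothing_continuous f t :
  (forall t, continuous f t) -> continuous (smoothing f) t.
Proof.
  intros Hf; apply (ex_derive_continuous (smoothing f)).
  eexists; now apply is_derive_smoothing.
Qed.

(** The windows of [t - 1] and [t] are [2 * t - 3, 2 * t - 1] and
    [2 * t - 1, 2 * t + 1]; for [t] in [0, 1] their union contains [-1, 1], so
    the two values add up to the total mass. *)
Lemma smoothing_tiling c f : tiling c f -> tiling c (smoothing f).
Proof.
  intros Hf; split.
  - intros t; apply smoothing_continuous, (tiling_continuous c f Hf).
  - intros t Ht; unfold smoothing; apply RInt_zero; [lra |].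
    intros u Hu; apply (tiling_outside c f Hf).
    revert Ht; unfold Rabs; repeat destruct Rcase_abs; lra.
  - intros t Ht; unfold smoothing.
    replace (2 * t - 1) with (2 * (t - 1) + 1) by ring.
    rewrite Rplus_comm, <- RInt_cut by apply (tiling_continuous c f Hf).
    apply (tiling_mass c); lra || easy.
Qed.

Lemma smoothing_nonneg f t :
  (forall t, continuous f t) -> (forall t, 0 <= f t) -> 0 <= smoothing f t.
Proof.
  intros Hf Hpos; apply RInt_ge_0; [lra | now apply continuous_ex_RInt | auto].
Qed.

Lemma smoothing_minus f g t :
  (forall t, continuous f t) -> (forall t, continuous g t) ->
  smoothing (fun t => f t - g t) t = smoothing f t - smoothing g t.
Proof.
  intros Hf Hg; apply (RInt_minus f g); now apply continuous_ex_RInt.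
Qed.

(** * The contraction estimate *)

Lemma RInt_dominated (f P v : R -> R) (a b : R) :
  a <= b -> (forall t, continuous f t) ->
  (forall t, is_derive P t (v t)) -> (forall t, continuous v t) ->
  (forall t, a <= t <= b -> Rabs (f t) <= v t) ->
  Rabs (RInt f a b) <= P b - P a.
Proof.
  intros Hab Hf HP Hv Hfv.
  apply (norm_RInt_le f v a b); auto.
  - now apply (RInt_correct f), continuous_ex_RInt.
  - apply (is_RInt_derive P v); auto.
Qed.

(** Bounds are imposed on [-1, 0] only: when [d] has mass 0, the relation
    [d t = - d (t - 1)] carries them to [0, 1]. *)
Definition dominated (d v : R -> R) : Prop :=
  forall x, 0 <= x <= 1 -> Rabs (d (x - 1)) <= v x.

(** The value at [x - 1] is the integral of [d] over [-1, 2 * x - 1].  For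
    [x <= 1 / 2] this interval lies in [-1, 0], where [v] bounds [d] directly.
    For larger [x], the total mass being 0, it is the opposite of the integral
    over [2 * x - 1, 1], where the symmetry of [v] reduces the estimate to the
    previous one with [1 - x] in place of [x]. *)
Lemma smoothing_dominated (d P v w : R -> R) :
  tiling 0 d ->
  (forall x, is_derive P x (v x)) -> (forall x, continuous v x) ->
  (forall x, v (1 - x) = v x) -> (forall x, w (1 - x) = w x) ->
  (forall x, 0 <= x <= 1 / 2 -> P (2 * x) - P 0 <= w x) ->
  dominated d v -> dominated (smoothing d) w.
Proof.
  intros Hd HP Hv Sv Sw Hw Hdv x Hx.
  assert (Hc := tiling_continuous 0 d Hd).
  assert (E : smoothing d (x - 1) = RInt d (-1) (2 * x - 1)).
  { unfold smoothing; rewrite (RInt_cut d (-1)), RInt_zero; auto; try lra.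
    - replace (2 * (x - 1) + 1) with (2 * x - 1) by ring; ring.
    - intros t Ht; apply (tiling_left 0); lra || easy. }
  rewrite E; destruct (Rle_dec x (1 / 2)) as [Hx2 | Hx2].
  - eapply Rle_trans; [| apply Hw; lra].
    replace (P (2 * x)) with (P (2 * x - 1 + 1)) by (f_equal; ring).
    replace (P 0) with (P (-1 + 1)) by (f_equal; ring).
    apply (RInt_dominated d (fun t => P (t + 1)) (fun t => v (t + 1)));
      auto; try lra.
    + intros t; evar_last.
      * apply (is_derive_comp P (fun t => t + 1)); [apply HP |].
        auto_derive; [easy | reflexivity].
      * unfold scal; simpl; unfold mult; simpl; ring.
    + intros t; apply (continuous_comp (fun t => t + 1) v); auto.
      apply (continuous_plus (fun t : R => t) (fun _ => 1));
        [apply continuous_id | apply continuous_const].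
    + intros t Ht; replace t with (t + 1 - 1) at 1 by ring; apply Hdv; lra.
  - assert (E' := tiling_mass 0 d (-1) 1 Hd ltac:(lra) ltac:(lra)).
    rewrite (RInt_cut d (2 * x - 1)) in E' by easy.
    replace (RInt d (-1) (2 * x - 1)) with (- RInt d (2 * x - 1) 1) by lra.
    rewrite Rabs_Ropp, <- Sw.
    eapply Rle_trans; [| apply Hw; lra].
    replace (P (2 * (1 - x)) - P 0)
      with (- P (1 - 1) - - P (1 - (2 * x - 1))).
    2: replace (1 - 1) with 0 by ring;
       replace (1 - (2 * x - 1)) with (2 * (1 - x)) by ring; ring.
    apply (RInt_dominated d (fun t => - P (1 - t)) v); auto; try lra.
    + intros t; evar_last.
      * apply (is_derive_opp (fun t => P (1 - t))).
        apply (is_derive_comp P (fun t => 1 - t)); [apply HP |].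
        auto_derive; [easy | reflexivity].
      * rewrite Sv; unfold opp, scal; simpl; unfold mult; simpl; ring.
    + intros t Ht.
      replace (d t) with (- d (t - 1))
        by (generalize (tiling_sum 0 d Hd t ltac:(lra)); lra).
      rewrite Rabs_Ropp; apply Hdv; lra.
Qed.

(** For a constant bound the integral is at most [2 * M * x] for
    [x <= 1 / 2], which lies below the parabola since [1 - x >= 1 / 2]. *)
Lemma smoothing_dominated_const d M :
  tiling 0 d -> dominated d (fun _ => M) ->
  dominated (smoothing d) (fun x => 4 * M * (x * (1 - x))).
Proof.
  intros Hd HM.
  assert (0 <= M).
  { eapply Rle_trans; [apply Rabs_pos | apply (HM 0); lra]. }
  apply (smoothing_dominated d (fun x => M * x) (fun _ => M)); auto.
  - intros x; auto_derive; [easy | ring].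
  - intros x; apply continuous_const.
  - intros x; ring.
  - intros x Hx.
    assert (0 <= M * (x * (1 - 2 * x))) by (repeat apply Rmult_le_pos; lra).
    lra.
Qed.

(** The gain 2/3 is the maximum of the ratio of
    [x ^ 2 / 2 - x ^ 3 / 3], taken at [2 * x], to [x * (1 - x)] on
    [0, 1 / 2]; it is attained at [x = 1 / 2], whence the square
    [(1 - 2 * x) ^ 2] in the gap between the two sides. *)
Lemma smoothing_dominated_parabola d C :
  0 <= C -> tiling 0 d -> dominated d (fun x => C * (x * (1 - x))) ->
  dominated (smoothing d) (fun x => 2 / 3 * C * (x * (1 - x))).
Proof.
  intros HC Hd HdC.
  apply (smoothing_dominated d (fun x => C * (x ^ 2 / 2 - x ^ 3 / 3))
           (fun x => C * (x * (1 - x)))); auto.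
  - intros x; auto_derive; [easy | field].
  - intros x; apply (ex_derive_continuous (fun x => C * (x * (1 - x)))).
    auto_derive; easy.
  - intros x; ring.
  - intros x; ring.
  - intros x Hx.
    replace (2 / 3 * C * (x * (1 - x)))
      with (C * (((2 * x) ^ 2 / 2 - (2 * x) ^ 3 / 3) - (0 ^ 2 / 2 - 0 ^ 3 / 3))
            + C * (2 / 3 * x * (1 - 2 * x) ^ 2)) by field.
    assert (0 <= C * (2 / 3 * x * (1 - 2 * x) ^ 2)).
    { apply Rmult_le_pos; [easy |].
      apply Rmult_le_pos; [lra | apply pow2_ge_0]. }
    lra.
Qed.

Definition density (f : R -> R) : Prop := tiling 1 f /\ forall t, 0 <= f t.

Lemma smoothing_density f : density f -> density (smoothing f).
Proof.
  intros [Hf Hpos]; split; [now apply smoothing_tiling |].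
  intros t; apply smoothing_nonneg; [apply (tiling_continuous 1 f Hf) | easy].
Qed.

Lemma iter_density n f : density f -> density (Nat.iter n smoothing f).
Proof. apply Nat.iter_invariant; exact smoothing_density. Qed.

Lemma density_minus f g : density f -> density g -> tiling 0 (fun t => f t - g t).
Proof.
  intros [Hf _] [Hg _]; replace 0 with (1 - 1) by ring; now apply tiling_minus.
Qed.

Lemma smoothing_density_minus f g v :
  density f -> density g ->
  dominated (smoothing (fun t => f t - g t)) v ->
  dominated (fun t => smoothing f t - smoothing g t) v.
Proof.
  intros [Hf _] [Hg _] H x Hx; rewrite <- smoothing_minus; auto.
  - apply (tiling_continuous 1 f Hf).
  - apply (tiling_continuous 1 g Hg).
Qed.

(** The first smoothing step turns the trivial bound 1 on the difference of two
    densities into a multiple of the parabola; each later one gains 2/3. *)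
Lemma iter_dominated n f g :
  density f -> density g ->
  dominated (fun t => Nat.iter (S n) smoothing f t - Nat.iter (S n) smoothing g t)
    (fun x => 4 * (2 / 3) ^ n * (x * (1 - x))).
Proof.
  intros Hf Hg; induction n as [| n IH].
  - simpl; apply smoothing_density_minus; auto.
    apply smoothing_dominated_const; [now apply density_minus |].
    intros x _.
    generalize (proj2 Hf (x - 1)) (proj2 Hg (x - 1))
      (tiling_bounded f (x - 1) (proj1 Hf) (proj2 Hf))
      (tiling_bounded g (x - 1) (proj1 Hg) (proj2 Hg)); intros.
    apply Rabs_le; lra.
  - replace (4 * (2 / 3) ^ S n) with (2 / 3 * (4 * (2 / 3) ^ n)) by (simpl; ring).
    apply (iter_density (S n)) in Hf; apply (iter_density (S n)) in Hg.
    apply smoothing_density_minus; auto.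
    apply smoothing_dominated_parabola; auto.
    + generalize (pow_le (2 / 3) n); lra.
    + now apply density_minus.
Qed.

Lemma iter_contraction n f g t :
  density f -> density g ->
  Rabs (Nat.iter (S n) smoothing f t - Nat.iter (S n) smoothing g t)
  <= (2 / 3) ^ n.
Proof.
  intros Hf Hg.
  assert (Hd := iter_dominated n f g Hf Hg).
  assert (Hz := density_minus _ _ (iter_density (S n) f Hf)
                  (iter_density (S n) g Hg)).
  revert Hd Hz.
  set (d := fun t => Nat.iter (S n) smoothing f t - Nat.iter (S n) smoothing g t).
  change (dominated d (fun x => 4 * (2 / 3) ^ n * (x * (1 - x))) ->
          tiling 0 d -> Rabs (d t) <= (2 / 3) ^ n).
  intros Hd Hz.
  assert (0 <= (2 / 3) ^ n) by (apply pow_le; lra).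
  assert (B : forall x, 0 <= x <= 1 -> Rabs (d (x - 1)) <= (2 / 3) ^ n).
  { intros x Hx; eapply Rle_trans; [now apply Hd |].
    generalize (pow2_ge_0 (1 - 2 * x)); nra. }
  destruct (Rle_dec 1 (Rabs t)) as [Ht | Ht].
  - rewrite (tiling_outside 0 d), Rabs_R0; easy.
  - assert (t < 1 /\ - (1) < t) by (apply Rabs_def2; lra).
    destruct (Rle_dec 0 t).
    + replace (d t) with (- d (t - 1))
        by (generalize (tiling_sum 0 d Hz t ltac:(lra)); lra).
      rewrite Rabs_Ropp; apply B; lra.
    + replace t with (t + 1 - 1) by ring; apply B; lra.
Qed.

(** * The fixed point *)

Lemma pow_two_thirds_small eps :
  0 < eps -> exists N, forall n, (N <= n)%nat -> (2 / 3) ^ n < eps.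
Proof.
  intros He.
  destruct (pow_lt_1_zero (2 / 3) ltac:(rewrite Rabs_right; lra) eps He)
    as [N HN].
  exists N; intros n Hn; generalize (HN n Hn).
  rewrite Rabs_right; auto. apply Rle_ge, pow_le; lra.
Qed.

Lemma density_fixed_unique f g :
  density f -> density g ->
  (forall t, smoothing f t = f t) -> (forall t, smoothing g t = g t) ->
  f = g.
Proof.
  intros Hf Hg Ff Fg.
  apply functional_extensionality in Ff; apply functional_extensionality in Fg.
  assert (I : forall h n, smoothing h = h -> Nat.iter n smoothing h = h).
  { intros h n Hh; induction n as [| n IH]; simpl; [easy | now rewrite IH]. }
  apply functional_extensionality; intros t.
  apply Rminus_diag_uniq, Rabs_eq_0, Rle_antisym; [| apply Rabs_pos].
  apply le_epsilon; intros eps He; rewrite Rplus_0_l.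
  destruct (pow_two_thirds_small eps He) as [n Hn].
  generalize (iter_contraction n f g t Hf Hg) (Hn n (le_n n)).
  rewrite !I by easy; lra.
Qed.

Definition hat (t : R) : R := Rmax 0 (1 - Rabs t).

Lemma hat_density : density hat.
Proof.
  split; [split |].
  - intros t.
    apply continuity_pt_filterlim.
    apply (continuity_pt_ext (fun t => (1 - Rabs t + Rabs (1 - Rabs t)) / 2)).
    + intros u; unfold hat, Rmax; destruct Rle_dec; unfold Rabs at 2;
        destruct Rcase_abs; lra.
    + assert (C : continuity_pt (fun t => 1 - Rabs t) t).
      { apply continuity_pt_minus; [now apply continuity_pt_const |].
        apply Rcontinuity_abs. }
      apply (continuity_pt_mult (fun t => 1 - Rabs t + Rabs (1 - Rabs t))
               (fun _ => / 2)).
      * apply continuity_pt_plus; [exact C |].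
        apply (continuity_pt_comp (fun t => 1 - Rabs t) Rabs); auto.
        apply Rcontinuity_abs.
      * now apply continuity_pt_const.
  - intros t Ht; unfold hat; apply Rmax_left; lra.
  - intros t Ht; unfold hat.
    rewrite (Rabs_right t), (Rabs_left1 (t - 1)), !Rmax_right; lra.
  - intros t; apply Rmax_l.
Qed.

(** This limit is Rvachev's up function. *)
Definition up_function (t : R) : R := real (Lim_seq (fun n => Nat.iter n smoothing hat t)).

(** The iterate of rank [m >= n + 1] is the [n + 1]st iterate of another
    density, namely of the iterate of rank [m - (n + 1)], so the contraction
    estimate bounds its distance to the [n + 1]st iterate of [hat] without
    summing a series.  This gives convergence and, for [m] tending to infinity,
    a rate that is uniform in [t]. *)
Lemma up_approx n t :
  is_lim_seq (fun n => Nat.iter n smoothing hat t) (up_function t) /\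
  Rabs (Nat.iter (S n) smoothing hat t - up_function t) <= (2 / 3) ^ n.
Proof.
  assert (C : forall n m, (S n <= m)%nat ->
     Rabs (Nat.iter (S n) smoothing hat t - Nat.iter m smoothing hat t)
     <= (2 / 3) ^ n).
  { intros p m Hm; replace m with (S p + (m - S p))%nat by lia.
    rewrite Nat.iter_add; apply iter_contraction;
      [| apply iter_density]; exact hat_density. }
  assert (L : is_lim_seq (fun n => Nat.iter n smoothing hat t) (up_function t)).
  { apply Lim_seq_correct', ex_lim_seq_cauchy_corr.
    intros eps.
    destruct (pow_two_thirds_small (eps / 2)) as [N HN].
    { generalize (cond_pos eps); lra. }
    exists (S N); intros p q Hp Hq.
    generalize (C N p Hp) (C N q Hq) (HN N (le_n N)).
    set (a := Nat.iter (S N) smoothing hat t).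
    set (b := Nat.iter p smoothing hat t); set (c := Nat.iter q smoothing hat t).
    intros H1 H2 H3.
    replace (b - c) with (- (a - b) + (a - c)) by ring.
    generalize (Rabs_triang (- (a - b)) (a - c)); rewrite Rabs_Ropp; lra. }
  split; [exact L |].
  apply (is_lim_seq_le_loc
    (fun m => Rabs (Nat.iter (S n) smoothing hat t - Nat.iter m smoothing hat t))
    (fun _ => (2 / 3) ^ n)
    (Rabs (Nat.iter (S n) smoothing hat t - up_function t)) ((2 / 3) ^ n)).
  - exists (S n); intros m Hm; now apply C.
  - apply (is_lim_seq_abs _
             (Finite (Nat.iter (S n) smoothing hat t - up_function t))).
    apply is_lim_seq_minus'; [apply is_lim_seq_const | exact L].
  - apply is_lim_seq_const.
Qed.

Lemma up_uniform_limit :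
  filterlim (fun n => Nat.iter n smoothing hat) eventually
    (locally (up_function : fct_UniformSpace R R_UniformSpace)).
Proof.
  apply filterlim_locally; intros eps.
  destruct (pow_two_thirds_small eps (cond_pos eps)) as [N HN].
  exists (S N); intros [| n] Hn t; [lia |].
  apply Rle_lt_trans with ((2 / 3) ^ n); [now apply up_approx | apply HN; lia].
Qed.

Lemma up_density : density up_function.
Proof.
  assert (L := fun t => proj1 (up_approx 0 t)).
  assert (D := fun n => iter_density n hat hat_density).
  split; [split |].
  - intros t.
    apply (filterlim_switch_1 eventually _ (locally t) _
             (fun n => Nat.iter n smoothing hat) up_function
             (fun n => Nat.iter n smoothing hat t) (up_function t)).
    + exact up_uniform_limit.
    + intros n; apply (tiling_continuous 1), D.
    + apply L.
  - intros t Ht.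
    assert (E : Finite (up_function t) = Finite 0).
    { rewrite <- (is_lim_seq_unique _ _ (L t)).
      rewrite (Lim_seq_ext _ (fun _ => 0)); [apply Lim_seq_const |].
      intros n; apply (tiling_outside 1); [apply D | easy]. }
    now injection E.
  - intros t Ht.
    assert (E : Finite (up_function t + up_function (t - 1)) = Finite 1).
    { rewrite <- (is_lim_seq_unique _ _ (is_lim_seq_plus' _ _ _ _ (L t) (L (t - 1)))).
      rewrite (Lim_seq_ext _ (fun _ => 1)); [apply Lim_seq_const |].
      intros n; apply (tiling_sum 1); [apply D | easy]. }
    now injection E.
  - intros t.
    apply (is_lim_seq_le (fun _ => 0) (fun n => Nat.iter n smoothing hat t) 0 (up_function t)).
    + intros n; apply D.
    + apply is_lim_seq_const.
    + apply L.
Qed.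

(** By uniform convergence the window integrals of the iterates, which are the
    next iterates, converge to those of the limit. *)
Lemma smoothing_up t : smoothing up_function t = up_function t.
Proof.
  destruct (filterlim_RInt (fun n => Nat.iter n smoothing hat)
              (2 * t - 1) (2 * t + 1) eventually _ up_function
              (fun n => Nat.iter (S n) smoothing hat t)) as [l [Hl HI]].
  - intros n; apply (RInt_correct (Nat.iter n smoothing hat)), continuous_ex_RInt.
    apply (tiling_continuous 1), iter_density, hat_density.
  - exact up_uniform_limit.
  - unfold smoothing; rewrite (is_RInt_unique _ _ _ _ HI).
    assert (L := proj1 (is_lim_seq_incr_1 _ _) (proj1 (up_approx 0 t))).
    apply (filterlim_locally_unique _ _ _ Hl L).
Qed.

(** * Positivity, smoothness and support *)

Lemma smoothing_positive f t p :
  (forall t, continuous f t) -> (forall t, 0 <= f t) ->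
  Rabs (p - 2 * t) < 1 -> 0 < f p -> 0 < smoothing f t.
Proof.
  intros Hf Hpos Hp Hfp; apply Rabs_def2 in Hp.
  assert (Hn : locally p (fun u => 0 < f u)).
  { apply (Hf p); apply (open_gt 0); exact Hfp. }
  destruct Hn as [e He].
  assert (He0 := cond_pos e).
  (* [a, b] is a neighbourhood of p, inside the window, on which f > 0. *)
  set (a := Rmax (2 * t - 1) (p - e / 2)).
  set (b := Rmin (2 * t + 1) (p + e / 2)).
  assert (Ha : 2 * t - 1 <= a < p /\ p - e / 2 <= a).
  { unfold a; generalize (Rmax_l (2 * t - 1) (p - e / 2))
      (Rmax_r (2 * t - 1) (p - e / 2)); intros.
    repeat split; auto; apply Rmax_lub_lt; lra. }
  assert (Hb : p < b <= 2 * t + 1 /\ b <= p + e / 2).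
  { unfold b; generalize (Rmin_l (2 * t + 1) (p + e / 2))
      (Rmin_r (2 * t + 1) (p + e / 2)); intros.
    repeat split; auto; apply Rmin_glb_lt; lra. }
  unfold smoothing; rewrite (RInt_cut f a), (RInt_cut f b a) by easy.
  assert (0 <= RInt f (2 * t - 1) a).
  { apply RInt_ge_0; auto; [lra | now apply continuous_ex_RInt]. }
  assert (0 <= RInt f b (2 * t + 1)).
  { apply RInt_ge_0; auto; [lra | now apply continuous_ex_RInt]. }
  assert (0 < RInt f a b).
  { apply RInt_gt_0; auto; [lra |].
    intros u Hu; apply He.
    apply (norm_compat1 (V := R_NormedModule)).
    apply Rabs_def1; unfold minus, plus, opp; simpl; lra. }
  lra.
Qed.

(** By induction on [n], [f] is positive on the interval of radius
    [1 - / 2 ^ n]: the next radius is the midpoint of this one and 1, so a point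
    [u] within the next radius has, within distance 1 of [2 * u], points of the
    smaller interval. *)
Lemma density_fixed_positive f t :
  density f -> (forall t, smoothing f t = f t) -> -1 < t < 1 -> 0 < f t.
Proof.
  intros [Hf Hpos] Ff Ht.
  assert (P : forall n u, Rabs u < 1 - / 2 ^ n -> 0 < f u).
  { induction n as [| n IH]; intros u Hu.
    - simpl in Hu; rewrite Rinv_1 in Hu; generalize (Rabs_pos u); lra.
    - rewrite <- Ff.
      assert (Hq : 0 < / 2 ^ n <= 1).
      { split; [apply Rinv_0_lt_compat, pow_lt; lra |].
        rewrite <- Rinv_1; apply Rinv_le_contravar; [lra |].
        apply pow_R1_Rle; lra. }
      replace (/ 2 ^ S n) with (/ 2 ^ n / 2) in Hu
        by (simpl; rewrite Rinv_mult; field; apply pow_nonzero; lra).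
      set (q := / 2 ^ n) in *.
      destruct (Req_dec u 0) as [-> | Hu0].
      { apply smoothing_positive with 0; auto.
        - apply (tiling_continuous 1 f Hf).
        - rewrite Rabs_right; lra.
        - rewrite (tiling_at_0 1 f Hf); lra. }
      assert (Hu1 := Rabs_pos_lt u Hu0).
      assert (Hc : 0 <= 2 * (1 - q) / (2 - q)).
      { apply Rmult_le_pos; [lra | left; apply Rinv_0_lt_compat; lra]. }
      assert (Hc' : 0 < 2 / (2 - q)).
      { apply Rmult_lt_0_compat; [lra | apply Rinv_0_lt_compat; lra]. }
      (* With r = 1 - q, the point p = 2 r / (1 + r) * u satisfies both
         |p| < r and |p - 2 u| < 1 exactly when |u| < (1 + r) / 2. *)
      apply smoothing_positive with (2 * (1 - q) / (2 - q) * u); auto.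
      + apply (tiling_continuous 1 f Hf).
      + replace (2 * (1 - q) / (2 - q) * u - 2 * u)
          with (- (2 / (2 - q) * u)) by (field; lra).
        rewrite Rabs_Ropp, Rabs_mult, (Rabs_right (2 / (2 - q))) by lra.
        apply Rlt_le_trans with (2 / (2 - q) * (1 - q / 2)).
        * now apply Rmult_lt_compat_l.
        * right; field; lra.
      + (* The radius is 0 for n = 0, where only p = 0 is available. *)
        destruct (Req_dec q 1) as [Hq1 | Hq1].
        * rewrite Hq1; replace (2 * (1 - 1) / (2 - 1) * u) with 0 by field.
          rewrite (tiling_at_0 1 f Hf); lra.
        * apply IH.
          rewrite Rabs_mult, (Rabs_right (2 * (1 - q) / (2 - q))) by lra.
          apply Rlt_le_trans with (2 * (1 - q) / (2 - q) * (1 - q / 2)).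
          -- apply Rmult_lt_compat_l; [| easy].
             apply Rmult_lt_0_compat; [lra | apply Rinv_0_lt_compat; lra].
          -- right; field; lra. }
  assert (Ht' : Rabs t < 1) by (apply Rabs_def1; lra).
  destruct (pow_lt_1_zero (/ 2) ltac:(rewrite Rabs_right; lra) (1 - Rabs t))
    as [N HN]; [lra |].
  apply (P N).
  generalize (HN N (le_n N)); rewrite pow_inv.
  rewrite (Rabs_right (/ 2 ^ N)); [lra |].
  apply Rle_ge; left; apply Rinv_0_lt_compat, pow_lt; lra.
Qed.

(** The right-hand side of the equation is as many times differentiable as [f],
    so each order of differentiability gives the next. *)
Lemma delay_smooth k f :
  (forall t, is_derive f t (k * (f (2 * t + 1) - f (2 * t - 1)))) -> smooth f.
Proof.
  intros Hf.
  assert (P : forall n m, (m <= n)%nat -> forall t, ex_derive_n f m t).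
  { induction n as [| n IH]; intros m Hm t.
    - replace m with 0%nat by lia; easy.
    - destruct m as [| [| m]]; [easy | eexists; apply Hf |].
      assert (B : ex_derive_n
                (fun t => k * (f (2 * t + 1) - f (2 * t - 1))) (S m) t).
      { apply ex_derive_n_scal_l, ex_derive_n_minus;
          apply filter_forall; intros x j Hj;
          apply (ex_derive_n_comp_scal (fun t => f (t + _)));
          apply filter_forall; intros y i Hi;
          apply ex_derive_n_comp_trans, IH; lia. }
      simpl; simpl in B.
      apply (ex_derive_ext
        (Derive_n (fun t => k * (f (2 * t + 1) - f (2 * t - 1))) m)); auto.
      intros u.
      rewrite (Derive_n_ext _ (Derive f))
        by (intros x; symmetry; apply is_derive_unique, Hf).
      generalize (Derive_n_comp f m 1 u).
      now rewrite Nat.add_1_r. }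
  intros n; now apply (P n).
Qed.

Lemma supp_interval f :
  (forall t, 1 <= Rabs t -> f t = 0) -> (forall t, -1 < t < 1 -> 0 < f t) ->
  forall t, supp f t <-> -1 <= t <= 1.
Proof.
  intros Z P t; split.
  - intros Ht.
    assert (C : closed_set (fun c => -1 <= c <= 1)) by apply compact_P2, compact_P3.
    apply (adherence_P2 _ C t).
    apply (adherence_P4 (fun t => f t <> 0)); auto.
    intros u Hu; split; apply Rnot_lt_le; intros H; apply Hu, Z.
    + rewrite Rabs_left; lra.
    + rewrite Rabs_right; lra.
  - intros Ht V [e He].
    assert (He0 := cond_pos e).
    assert (Hm : 0 < Rmin e 1) by (apply Rmin_glb_lt; lra).
    generalize (Rmin_l e 1) (Rmin_r e 1); intros.
    exists (t * (1 - Rmin e 1 / 2)); split.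
    + apply He; unfold disc.
      replace (t * (1 - Rmin e 1 / 2) - t) with (- (t * (Rmin e 1 / 2))) by ring.
      rewrite Rabs_Ropp; apply Rabs_def1; nra.
    + apply Rgt_not_eq, P; nra.
Qed.

(** * Solutions of the delay equation *)

Lemma zero_off_supp f t : (forall t, supp f t <-> -1 <= t <= 1) ->
  ~ (-1 <= t <= 1) -> f t = 0.
Proof.
  intros Hs Ht; destruct (Req_dec (f t) 0) as [| Hne]; [easy | exfalso].
  apply Ht, Hs; now apply adherence_P1.
Qed.

Lemma continuous_vanishing f (l : R) :
  continuous f l ->
  (forall e : posreal, exists u, Rabs (u - l) < e /\ f u = 0) -> f l = 0.
Proof.
  intros Hc Hz.
  destruct (Req_dec (f l) 0) as [| Hne]; [easy | exfalso].
  assert (Hn : locally l (fun u => f u <> 0)).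
  { apply (Hc (fun y => y <> 0)), (open_neq 0); exact Hne. }
  destruct Hn as [e He]; destruct (Hz e) as [u [Hu Hfu]].
  now apply (He u Hu).
Qed.

(** [f] and [k / 2 * smoothing f] have the same derivative and both vanish at
    -1.  Two consecutive windows then show that [f t + f (t - 1)] does not
    depend on [t] in [0, 1], and at [t = 0] it is [f 0 = 1]. *)
Lemma delay_tiling f k :
  test_function f -> normalized_bump f -> delay_equation k f ->
  tiling 1 f /\ forall t, f t = k / 2 * smoothing f t.
Proof.
  intros [Hsm _] [Hs [_ H0]] Hk.
  assert (D : forall t, is_derive f t (k * (f (2 * t + 1) - f (2 * t - 1)))).
  { intros t; rewrite <- Hk; apply Derive_correct, (Hsm 1%nat t). }
  assert (C : forall t, continuous f t).
  { intros t; apply (ex_derive_continuous f); eexists; apply D. }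
  assert (Z : forall t, 1 <= Rabs t -> f t = 0).
  { intros t Ht; apply continuous_vanishing; auto; intros e.
    assert (He := cond_pos e).
    destruct (Rle_dec 0 t) as [Ht0 | Ht0].
    - rewrite Rabs_right in Ht by lra.
      exists (t + e / 2); split; [apply Rabs_def1; lra |].
      apply zero_off_supp; [easy | lra].
    - rewrite Rabs_left in Ht by lra.
      exists (t - e / 2); split; [apply Rabs_def1; lra |].
      apply zero_off_supp; [easy | lra]. }
  assert (ZL : forall t, t <= -1 -> f t = 0)
    by (intros t Ht; apply Z; rewrite Rabs_left; lra).
  assert (ZR : forall t, 1 <= t -> f t = 0)
    by (intros t Ht; apply Z; rewrite Rabs_right; lra).
  assert (E : forall t, f t = k / 2 * smoothing f t).
  { intros t; destruct (Rle_dec t (-1)) as [Ht | Ht].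
    - unfold smoothing; rewrite ZL, RInt_zero; try lra.
      intros u Hu; apply ZL; lra.
    - assert (Q : f (-1) - k / 2 * smoothing f (-1)
                  = f t - k / 2 * smoothing f t).
      { apply (eq_is_derive (fun t => f t - k / 2 * smoothing f t)); [| lra].
        intros u _; evar_last.
        - apply (is_derive_minus f (fun t => k / 2 * smoothing f t)); [apply D |].
          apply (is_derive_scal (smoothing f)).
          now apply is_derive_smoothing.
        - unfold minus, plus, opp, zero; simpl; field. }
      replace (smoothing f (-1)) with 0 in Q.
      + rewrite ZL in Q; lra.
      + symmetry; apply RInt_zero; [lra |]; intros u Hu; apply ZL; lra. }
  split; [split |]; auto.
  assert (W : forall a, a <= -1 -> RInt f a 1 = RInt f (-1) 1).
  { intros a Ha; rewrite (RInt_cut f (-1)), (RInt_zero f a); try lra; auto.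
    intros u Hu; apply ZL; lra. }
  assert (V : forall b, 1 <= b -> RInt f 1 b = 0).
  { intros b Hb; apply RInt_zero; auto; intros u Hu; apply ZR; lra. }
  assert (M : forall t, 0 <= t <= 1 -> f t + f (t - 1) = k / 2 * RInt f (-1) 1).
  { intros t Ht.
    rewrite (E t), (E (t - 1)), <- Rmult_plus_distr_l; f_equal; unfold smoothing.
    replace (2 * t - 1) with (2 * (t - 1) + 1) by ring.
    rewrite Rplus_comm, <- RInt_cut, (RInt_cut f 1) by easy.
    rewrite V, W; lra. }
  intros t Ht; rewrite M by easy.
  rewrite <- (M 0) by lra; rewrite H0, ZL; lra.
Qed.

(** At [t = 0] the integral form reads [1 = k / 2 * RInt f (-1) 1], and the mass
    of [f] is 1. *)
Lemma delay_constant f k :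
  test_function f -> normalized_bump f -> delay_equation k f -> k = 2.
Proof.
  intros Ht Hb Hk; destruct (delay_tiling f k Ht Hb Hk) as [Hf E].
  generalize (E 0); unfold smoothing.
  rewrite (tiling_at_0 1 f), (tiling_mass 1); auto; lra.
Qed.

Lemma delay_fixed_density f k :
  test_function f -> normalized_bump f -> delay_equation k f ->
  density f /\ forall t, smoothing f t = f t.
Proof.
  intros Ht Hb Hk; destruct (delay_tiling f k Ht Hb Hk) as [Hf E].
  rewrite (delay_constant f k Ht Hb Hk) in E.
  split; [split; auto | intros t; rewrite (E t); lra].
  intros t; destruct (Rle_dec 1 (Rabs t)) as [H | H].
  - rewrite (tiling_outside 1 f); lra || easy.
  - left; apply Hb; apply Rnot_le_lt, Rabs_def2 in H; lra.
Qed.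

Theorem theorem1 :
  (exists! phi : R -> R,
     test_function phi /\ normalized_bump phi /\
     exists k : R, k > 0 /\ delay_equation k phi) /\
  (forall (phi : R -> R) (k : R),
     test_function phi -> normalized_bump phi ->
     k > 0 -> delay_equation k phi -> k = 2).
Proof.
  split.
  2: { intros phi k Ht Hb _ Hk; now apply (delay_constant phi). }
  exists up_function; split.
  - assert (Hd := up_density); destruct Hd as [Hf Hpos].
    assert (D : forall t, is_derive up_function t (2 * (up_function (2 * t + 1) - up_function (2 * t - 1)))).
    { intros t; apply (is_derive_ext (smoothing up_function)); [exact smoothing_up |].
      apply is_derive_smoothing, (tiling_continuous 1 up_function Hf). }
    assert (P : forall t, -1 < t < 1 -> 0 < up_function t).
    { intros t; apply density_fixed_positive;
        [exact up_density | exact smoothing_up]. }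
    assert (S := supp_interval up_function (tiling_outside 1 up_function Hf) P).
    split; [split | split; [split; [| split] |]].
    + now apply (delay_smooth 2).
    + apply (compact_eqDom _ _ (compact_P3 (-1) 1)).
      split; intros t; apply S.
    + exact S.
    + exact P.
    + now apply (tiling_at_0 1).
    + exists 2; split; [lra |].
      intros t; apply is_derive_unique, D.
  - intros psi [Ht [Hb [k [_ Hk]]]].
    destruct (delay_fixed_density psi k Ht Hb Hk).
    apply density_fixed_unique; auto; [exact up_density | exact smoothing_up].
Qed.
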